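(* Consider the formal differential parametrization of the Euler-Bernoulli beam whose sequence $(c_{k,0})_{k\in\mathbb{N}}$ (coefficients of $z^2$ in $\alpha_{2k}(z)$) is $$c_{k,0}=\frac{(-1)^k}{(4k)!}\,c_{0,0},\qquad k\ge 0,$$ with $c_{0,0}\in\mathbb{R}$. Then $$d_{k,0}=-\frac{4k(-1)^k}{3(4k)!}\,c_{0,0},\quad k\ge 0,\qquad \beta_{2k}=\begin{cases}2c_{0,0}, & k=0,\\ \dfrac{4^k}{(4k)!}\,c_{0,0}, & k\ge 1,\end{cases}$$ where $d_{k,0}$ is the coefficient of $z^3$ in $\alpha_{2k}(z)$. For $c_{0,0}=2$ the parametrization is $$w(z,t)=\sum_{k=0}^{\infty}4(-1)^k\sum_{i=0}^{k}\left(\frac{1}{(4i+2)!\,(4(k-i))!}z^{4i+2}-\frac{4(k-i)}{(4i+3)!\,(4(k-i))!}z^{4i+3}\right)y^{(2k)}(t),$$ $$u(t)=4y(t)+\sum_{k=1}^{\infty}2\,\frac{4^k}{(4k)!}\,y^{(2k)}(t).$$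
   Context: $\mathbb{N}$ includes $0$; $'$ denotes differentiation with respect to $z$; $y^{(m)}$ is the $m$-th time derivative of $y$. The Euler-Bernoulli beam is the system $\partial_t^2 w(z,t)=-\partial_z^4 w(z,t)$, $0\le z\le 1$, $t\ge 0$, with boundary conditions $w(0,t)=0$, $\partial_z w(0,t)=0$, $\partial_z^2 w(1,t)=u(t)$, $\partial_z^3 w(1,t)=0$, where $u(t)$ is the input. A formal differential parametrization (with time derivatives of even order only) consists of functions $\alpha_{2k}:[0,1]\to\mathbb{R}$ and real numbers $\beta_{2k}$, $k\in\mathbb{N}$, such that the series $w(z,t)=\sum_{k\ge 0}\alpha_{2k}(z)y^{(2k)}(t)$ and $u(t)=\sum_{k\ge 0}\beta_{2k}y^{(2k)}(t)$ formally (after interchanging differentiation and summation, without regard to convergence) satisfy the PDE and the boundary conditions for arbitrary smooth functions $y(t)$. This means that the factors of all time derivatives of $y$ vanish, i.e. $$\alpha_0''''(z)=0,\qquad \alpha_{2k}''''(z)=-\alpha_{2(k-1)}(z)\ \ (k\ge 1),$$ $$\alpha_{2k}(0)=0,\quad \alpha_{2k}'(0)=0,\quad \alpha_{2k}''(1)=\beta_{2k},\quad \alpha_{2k}'''(1)=0\ \ (k\ge 0).$$ The functions $\alpha_{2k}$ are then polynomials of the form $\alpha_{2k}(z)=\sum_{i=0}^{k}\left(c_{k,i}z^{4i+2}+d_{k,i}z^{4i+3}\right)$ with real coefficients $c_{k,i},d_{k,i}$ and $d_{k,k}=0$. For every real sequence $(c_{k,0})_{k\in\mathbb{N}}$ there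 is exactly one formal differential parametrization of this form having these numbers as coefficients of $z^2$ in the $\alpha_{2k}$. The series identities for $w$ and $u$ are to be understood formally, i.e. as identities for the coefficients $\alpha_{2k}(z)$ and $\beta_{2k}$. *)

(* Defs.v *)
From Stdlib Require Import Reals Factorial.
Local Open Scope R_scope.

Definition unit_interval (z : R) : Prop := 0 <= z <= 1.

(** [f'] is the derivative of [f] on [0,1]; the difference quotients are
    restricted to [0,1], so the derivatives at 0 and 1 are one-sided and the
    values of [f] outside [0,1] play no role. *)
Definition derivative_on (f f' : R -> R) : Prop :=
  forall z, unit_interval z -> D_in f f' unit_interval z.

(** Only even time derivatives of [y] occur: [alpha k] and [beta k] are the
    factors $\alpha_{2k}$ and $\beta_{2k}$ of $y^{(2k)}$ in the formal series
    for $w$ and $u$.  The functions [a1 k], [a2 k], [a3 k] are the first three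
    derivatives of [alpha k]; on [0,1] they are determined by [alpha k]. *)
Definition formal_differential_parametrization
    (alpha : nat -> R -> R) (beta : nat -> R) : Prop :=
  exists a1 a2 a3 : nat -> R -> R,
    (forall k : nat,
       derivative_on (alpha k) (a1 k) /\
       derivative_on (a1 k) (a2 k) /\
       derivative_on (a2 k) (a3 k)) /\
    derivative_on (a3 0%nat) (fun _ => 0) /\
    (forall k : nat, derivative_on (a3 (S k)) (fun z => - alpha k z)) /\
    (forall k : nat,
       alpha k 0 = 0 /\ a1 k 0 = 0 /\ a2 k 1 = beta k /\ a3 k 1 = 0).

(** The numbers [c k i] and [d k i] are only meaningful for [i <= k];
    note that [sum_f_R0 f k] has the [k + 1] terms [f 0, ..., f k]. *)
Definition polynomial_form
    (alpha : nat -> R -> R) (c d : nat -> nat -> R) : Prop :=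
  (forall (k : nat) (z : R), unit_interval z ->
     alpha k z =
     sum_f_R0 (fun i => c k i * z ^ (4 * i + 2) + d k i * z ^ (4 * i + 3)) k) /\
  (forall k : nat, d k k = 0).

Definition beam_parametrization
    (c00 : R) (alpha : nat -> R -> R) (beta : nat -> R)
    (c d : nat -> nat -> R) : Prop :=
  formal_differential_parametrization alpha beta /\
  polynomial_form alpha c d /\
  (forall k : nat, c k 0%nat = (-1) ^ k / INR (fact (4 * k)) * c00).

(* Main.v *)
Require Import Defs.
From Stdlib Require Import Reals Factorial.
From Stdlib Require Import Lra Lia.
Local Open Scope R_scope.

(** In the basis [z ^ n / n!] the PDE only shifts coefficients, so that
    [alpha k] is determined by the coefficients of [z ^ 2] and [z ^ 3] of
    [alpha 0], ..., [alpha k].  The condition [alpha k ''' (1) = 0] is then an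
    antisymmetric convolution under [i <-> k - i], and [alpha k '' (1)] is the
    combination [sum_i C (4k) (4i) - C (4k) (4i + 1)], which is evaluated by
    iterating Pascal's rule four times.  Uniqueness: two solutions with the same
    coefficient of [z ^ 2] differ by a function with vanishing fourth derivative
    and vanishing boundary data. *)

(** * Derivatives on the unit interval *)

(** One-sided limits are unique only at accumulation points of the domain. From the left half of the
    interval one moves right, from the right half left, by at most 1/2. *)
Lemma unit_interval_adherent (z : R) :
  unit_interval z -> adhDa (D_x unit_interval z) z.
Proof.
unfold unit_interval; intros Hz e He.
destruct (Rle_dec z (1 / 2)) as [Hle | Hgt].
- exists (z + Rmin (e / 2) (1 / 2)).
  pose proof (Rmin_l (e / 2) (1 / 2)); pose proof (Rmin_r (e / 2) (1 / 2)).
  assert (0 < Rmin (e / 2) (1 / 2)) by (apply Rmin_glb_lt; lra).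
  unfold D_x, Rdist; repeat split; try lra.
  rewrite Rabs_pos_eq; lra.
- exists (z - Rmin (e / 2) (1 / 2)).
  pose proof (Rmin_l (e / 2) (1 / 2)); pose proof (Rmin_r (e / 2) (1 / 2)).
  assert (0 < Rmin (e / 2) (1 / 2)) by (apply Rmin_glb_lt; lra).
  unfold D_x, Rdist; repeat split; try lra.
  rewrite Rabs_left; lra.
Qed.

Lemma derivative_on_ext (f g f' g' : R -> R) :
  (forall z, unit_interval z -> f z = g z) ->
  (forall z, unit_interval z -> f' z = g' z) ->
  derivative_on f f' -> derivative_on g g'.
Proof.
intros Hfg Hfg' Hf z Hz e He.
destruct (Hf z Hz e He) as [d [Hd Hlim]].
exists d; split; [exact Hd |].
intros x Hx; specialize (Hlim x Hx).
destruct Hx as [[Hx _] _].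
rewrite <- (Hfg x Hx), <- (Hfg z Hz), <- (Hfg' z Hz); exact Hlim.
Qed.

Lemma derivative_on_unique (f g f' g' : R -> R) :
  derivative_on f f' -> derivative_on g g' ->
  (forall z, unit_interval z -> f z = g z) ->
  forall z, unit_interval z -> f' z = g' z.
Proof.
intros Hf Hg Hfg z Hz.
apply (single_limit _ _ _ _ z (unit_interval_adherent z Hz) (Hf z Hz)).
apply (derivative_on_ext g f g' g'); auto.
intros x Hx; symmetry; auto.
Qed.

Lemma derivative_on_scal (a : R) (f f' : R -> R) :
  derivative_on f f' -> derivative_on (fun z => a * f z) (fun z => a * f' z).
Proof. intros Hf z Hz; apply Dmult_const, Hf, Hz. Qed.

Lemma derivative_on_plus (f g f' g' : R -> R) :
  derivative_on f f' -> derivative_on g g' ->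
  derivative_on (fun z => f z + g z) (fun z => f' z + g' z).
Proof. intros Hf Hg z Hz; apply Dadd; auto. Qed.

Lemma derivative_on_minus (f g f' g' : R -> R) :
  derivative_on f f' -> derivative_on g g' ->
  derivative_on (fun z => f z - g z) (fun z => f' z - g' z).
Proof. intros Hf Hg z Hz; apply Dminus; auto. Qed.

Lemma derivative_on_sum (f f' : nat -> R -> R) (n : nat) :
  (forall i, derivative_on (f i) (f' i)) ->
  derivative_on (fun z => sum_f_R0 (fun i => f i z) n)
                (fun z => sum_f_R0 (fun i => f' i z) n).
Proof.
intros Hf; induction n as [| n IH]; simpl; [apply Hf |].
apply derivative_on_plus; auto.
Qed.

Lemma clamp_unit_interval (x : R) : unit_interval (Rmax 0 (Rmin 1 x)).
Proof.
unfold unit_interval, Rmax, Rmin.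
destruct (Rle_dec 1 x); destruct (Rle_dec _ _); lra.
Qed.

Lemma clamp_id (x : R) : unit_interval x -> Rmax 0 (Rmin 1 x) = x.
Proof.
unfold unit_interval, Rmax, Rmin; intros Hx.
destruct (Rle_dec 1 x); destruct (Rle_dec _ _); lra.
Qed.

(** Lets difference quotients of the clamped extension be bounded by those of the original
    function. *)
Lemma clamp_dist (x h : R) :
  unit_interval x -> Rabs (Rmax 0 (Rmin 1 (x + h)) - x) <= Rabs h.
Proof.
unfold unit_interval, Rmax, Rmin; intros Hx.
destruct (Rle_dec 1 (x + h)); destruct (Rle_dec _ _);
  unfold Rabs; repeat destruct (Rcase_abs _); lra.
Qed.

(* The mean value theorem of the library needs two-sided derivatives, whence
   the extension of [f] by constants outside [0,1]. *)
Lemma null_derivative_on_const (f : R -> R) :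
  derivative_on f (fun _ => 0) ->
  forall x y, unit_interval x -> unit_interval y -> f x = f y.
Proof.
intros Hf.
set (g := fun x => f (Rmax 0 (Rmin 1 x))).
assert (Hg : forall x, unit_interval x -> derivable_pt_lim g x 0).
{ intros x Hx e He.
  destruct (Hf x Hx e He) as [d [Hd Hlim]].
  exists (mkposreal d Hd); simpl; intros h Hh Hhd.
  unfold g; rewrite (clamp_id x Hx).
  pose proof (clamp_dist x h Hx) as Hdist.
  pose proof (clamp_unit_interval (x + h)) as Hy.
  set (y := Rmax 0 (Rmin 1 (x + h))) in *; clearbody y.
  destruct (Req_dec y x) as [-> | Hyx].
  { replace ((f x - f x) / h - 0) with 0 by (field; exact Hh).
    rewrite Rabs_R0; exact He. }
  assert (Hq : Rabs ((f y - f x) / (y - x) - 0) < e).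
  { apply Hlim; split; [split; auto | simpl; unfold Rdist; lra]. }
  pose proof (Rabs_pos_lt h Hh) as Hpos.
  pose proof (Rabs_pos_lt (y - x) ltac:(lra)) as Hpos'.
  rewrite Rminus_0_r in *.
  (* Clamping scales the quotient by [(y - x) / h], of absolute value at most 1; since the
     derivative is 0, smallness survives this scaling. *)
  replace ((f y - f x) / h)
    with ((f y - f x) / (y - x) * ((y - x) / h)) by (field; lra).
  rewrite Rabs_mult.
  apply Rle_lt_trans with (Rabs ((f y - f x) / (y - x)) * 1); [| lra].
  apply Rmult_le_compat_l; [apply Rabs_pos |].
  unfold Rdiv; rewrite Rabs_mult, Rabs_inv.
  apply Rmult_le_reg_r with (Rabs h); [exact Hpos |].
  rewrite Rmult_assoc, Rinv_l; lra. }
assert (H0 : forall x, unit_interval x -> f x = f 0).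
{ intros x Hx; unfold unit_interval in Hx.
  destruct (Req_dec x 0) as [-> | Hx0]; [reflexivity |].
  destruct (MVT_cor2 g (fun _ => 0) 0 x) as [z [Heq _]]; [lra | |].
  { intros z Hz; apply Hg; unfold unit_interval; lra. }
  unfold g in Heq; rewrite !clamp_id in Heq; unfold unit_interval; lra. }
intros x y Hx Hy; rewrite (H0 x Hx), (H0 y Hy); reflexivity.
Qed.

(** Each function is constant once its derivative vanishes, and its value at one endpoint fixes the
    constant: first [e3] at 1, then [e2], [e1], [e] at 0. The condition on [e2 0] corresponds to
    prescribing the coefficient of [z ^ 2]. *)
Lemma beam_homogeneous_zero (e e1 e2 e3 : R -> R) :
  derivative_on e e1 -> derivative_on e1 e2 -> derivative_on e2 e3 ->
  derivative_on e3 (fun _ => 0) ->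
  e 0 = 0 -> e1 0 = 0 -> e2 0 = 0 -> e3 1 = 0 ->
  forall z, unit_interval z -> e z = 0 /\ e2 z = 0 /\ e3 z = 0.
Proof.
intros D0 D1 D2 D3 E0 E1 E2 E3.
assert (U0 : unit_interval 0) by (unfold unit_interval; lra).
assert (U1 : unit_interval 1) by (unfold unit_interval; lra).
assert (step : forall f f' a, derivative_on f f' ->
          (forall z, unit_interval z -> f' z = 0) ->
          unit_interval a -> f a = 0 ->
          forall z, unit_interval z -> f z = 0).
{ intros f f' a Hf Hf' Ha Hfa z Hz; rewrite <- Hfa.
  apply null_derivative_on_const; auto.
  apply (derivative_on_ext f f f' (fun _ => 0)); auto. }
assert (Z3 : forall z, unit_interval z -> e3 z = 0) by eauto.
assert (Z2 : forall z, unit_interval z -> e2 z = 0) by eauto.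
assert (Z1 : forall z, unit_interval z -> e1 z = 0) by eauto.
assert (Z0 : forall z, unit_interval z -> e z = 0) by eauto.
auto.
Qed.

(** * Beam polynomials *)

(* The [m]-th derivative of [z ^ n / n!]. *)
Definition dmono (n m : nat) (z : R) : R :=
  if Nat.ltb n m then 0 else z ^ (n - m) / INR (fact (n - m)).

Lemma dmono_deriv (n m : nat) : derivative_on (dmono n m) (dmono n (S m)).
Proof.
unfold dmono.
destruct (Nat.ltb_spec n m) as [Hnm | Hnm].
- destruct (Nat.ltb_spec n (S m)); [| lia].
  intros z _; apply Dconst.
- apply (derivative_on_ext
           (fun z => / INR (fact (n - m)) * z ^ (n - m)) _
           (fun z => / INR (fact (n - m)) * (INR (n - m) * z ^ (n - m - 1)))).
  + intros; unfold Rdiv; ring.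
  + intros z _.
    destruct (Nat.ltb_spec n (S m)) as [Hlt | Hge].
    (* Here [n = m], so the function differentiated is constant. *)
    * replace (n - m)%nat with 0%nat by lia; simpl; ring.
    * replace (n - m)%nat with (S (n - S m)) by lia.
      replace (S (n - S m) - 1)%nat with (n - S m)%nat by lia.
      rewrite fact_simpl, mult_INR.
      field; split; [apply INR_fact_neq_0 | apply not_0_INR; lia].
  + apply derivative_on_scal; intros z _; apply Dx_pow_n.
Qed.

Lemma dmono_0 (n m : nat) : dmono n m 0 = if Nat.eqb n m then 1 else 0.
Proof.
unfold dmono.
destruct (Nat.ltb_spec n m); destruct (Nat.eqb_spec n m); try lia; auto.
- subst; rewrite Nat.sub_diag; simpl; field.
- rewrite pow_i by lia; unfold Rdiv; ring.
Qed.

Lemma dmono_ge (n m : nat) (z : R) :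
  (m <= n)%nat -> dmono n m z = z ^ (n - m) / INR (fact (n - m)).
Proof. unfold dmono; destruct (Nat.ltb_spec n m); [lia | reflexivity]. Qed.

(* The [m]-th derivative of the polynomial with coefficients [p i] of
   [z ^ (4i+2) / (4i+2)!] and [q i] of [z ^ (4i+3) / (4i+3)!]. *)
Definition dbeam (p q : nat -> R) (k m : nat) (z : R) : R :=
  sum_f_R0 (fun i => p i * dmono (4 * i + 2) m z +
                     q i * dmono (4 * i + 3) m z) k.

Lemma dbeam_deriv (p q : nat -> R) (k m : nat) :
  derivative_on (dbeam p q k m) (dbeam p q k (S m)).
Proof.
unfold dbeam.
apply (derivative_on_sum
  (fun i z => p i * dmono (4 * i + 2) m z + q i * dmono (4 * i + 3) m z)
  (fun i z => p i * dmono (4 * i + 2) (S m) z + q i * dmono (4 * i + 3) (S m) z)).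
intros i; apply derivative_on_plus; apply derivative_on_scal, dmono_deriv.
Qed.

(** Up to order 3, all monomials with [i >= 1] keep a positive exponent, so only the block [i = 0]
    contributes. *)
Lemma dbeam_at_0 (p q : nat -> R) (k m : nat) :
  (m <= 3)%nat ->
  dbeam p q k m 0 = if Nat.eqb m 2 then p 0%nat
                    else if Nat.eqb m 3 then q 0%nat else 0.
Proof.
intros Hm; unfold dbeam.
induction k as [| k IH].
- simpl sum_f_R0; rewrite !dmono_0.
  destruct m as [| [| [| [| m]]]]; try lia; simpl; ring.
- rewrite tech5, IH, !dmono_0.
  destruct (Nat.eqb_spec (4 * S k + 2) m); [lia |].
  destruct (Nat.eqb_spec (4 * S k + 3) m); [lia |].
  ring.
Qed.

Lemma dbeam_fourth_0 (p q : nat -> R) (z : R) : dbeam p q 0 4 z = 0.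
Proof. unfold dbeam, dmono; simpl; ring. Qed.

Lemma dbeam_fourth_S (p q : nat -> R) (k : nat) (z : R) :
  dbeam p q (S k) 4 z = dbeam (fun i => p (S i)) (fun i => q (S i)) k 0 z.
Proof.
unfold dbeam; rewrite decomp_sum by lia.
replace (dmono (4 * 0 + 2) 4 z) with 0 by reflexivity.
replace (dmono (4 * 0 + 3) 4 z) with 0 by reflexivity.
rewrite !Rmult_0_r, Rplus_0_l, Rplus_0_l; simpl pred.
apply sum_eq; intros i _.
rewrite !dmono_ge by lia.
replace (4 * S i + 2 - 4)%nat with (4 * i + 2 - 0)%nat by lia.
replace (4 * S i + 3 - 4)%nat with (4 * i + 3 - 0)%nat by lia.
reflexivity.
Qed.

(** * Binomial sums over residue classes modulo 4 *)

(** This is [((1 + E)^n f) 0] for the shift operator [E]. *)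
Definition binomial_transform (f : nat -> R) (n : nat) : R :=
  sum_f_R0 (fun j => C n j * f j) n.

Lemma C_n_0 (n : nat) : C n 0 = 1.
Proof.
unfold C; rewrite Nat.sub_0_r; simpl; field; apply INR_fact_neq_0.
Qed.

Lemma C_n_n (n : nat) : C n n = 1.
Proof.
unfold C; rewrite Nat.sub_diag; simpl; field; apply INR_fact_neq_0.
Qed.

Lemma binomial_transform_S (f : nat -> R) (n : nat) :
  binomial_transform f (S n) =
  binomial_transform f n + binomial_transform (fun j => f (S j)) n.
Proof.
unfold binomial_transform.
destruct n as [| n]; [simpl; unfold C; simpl; field |].
(* Pascal's rule covers the interior terms; the first and last are split off. *)
rewrite (decomp_sum _ (S (S n))) by lia.
rewrite (decomp_sum (fun j => C (S n) j * f j)) by lia.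
simpl pred; rewrite (tech5 _ n), (tech5 _ n), !C_n_n, !C_n_0.
rewrite (sum_eq _ (fun i => C (S n) i * f (S i) + C (S n) (S i) * f (S i))).
- rewrite sum_plus; ring.
- intros i Hi; rewrite <- pascal by lia; ring.
Qed.

(** Rotating the arguments makes a shift of the sequence hold by computation. *)
Fixpoint periodic4 (a b c d : R) (j : nat) : R :=
  match j with
  | O => a
  | S j' => periodic4 b c d a j'
  end.

Lemma periodic4_mul (a b c d : R) (i : nat) : periodic4 a b c d (4 * i) = a.
Proof.
induction i as [| i IH]; [reflexivity |].
replace (4 * S i)%nat with (S (S (S (S (4 * i))))) by lia; exact IH.
Qed.

(** Expand [(1 + E)^4] and use [E^4 = 1], which merges the outer coefficients into 2. *)
Lemma binomial_transform_periodic4_step (a b c d : R) (n : nat) :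
  binomial_transform (periodic4 a b c d) (4 + n) =
  2 * binomial_transform (periodic4 a b c d) n +
  4 * binomial_transform (periodic4 b c d a) n +
  6 * binomial_transform (periodic4 c d a b) n +
  4 * binomial_transform (periodic4 d a b c) n.
Proof.
assert (S1 : forall a b c d m, binomial_transform (periodic4 a b c d) (S m) =
  binomial_transform (periodic4 a b c d) m +
  binomial_transform (periodic4 b c d a) m)
  by (intros; apply binomial_transform_S).
simpl plus; rewrite !S1; ring.
Qed.

(** On 4-periodic sequences [(1 + E)^4] has eigenvalue 16 for [E = 1], -4 for [E] equal to plus or
    minus the imaginary unit, and 0 for [E = -1]. The last component survives at exponent 0, so the
    formula starts at [4 * 1]. *)
Lemma binomial_transform_periodic4 (a b c d : R) (k : nat) :
  binomial_transform (periodic4 a b c d) (4 * S k) =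
  (a + b + c + d) * 16 ^ S k / 4 + (a - c) * (-4) ^ S k / 2.
Proof.
revert a b c d; induction k as [| k IH]; intros a b c d;
  [change (4 * 1)%nat with (4 + 0)%nat
  | replace (4 * S (S k))%nat with (4 + 4 * S k)%nat by lia];
  rewrite binomial_transform_periodic4_step.
- unfold binomial_transform; simpl; unfold C; simpl; field.
- rewrite !IH; simpl; field.
Qed.

Lemma sum_blocks4 (h : nat -> R) (k : nat) :
  sum_f_R0 h (4 * S k) =
  sum_f_R0 (fun i => h (4 * i)%nat + h (4 * i + 1)%nat +
                     h (4 * i + 2)%nat + h (4 * i + 3)%nat) k + h (4 * S k)%nat.
Proof.
induction k as [| k IH]; [simpl; ring |].
replace (4 * S (S k))%nat with (S (S (S (S (4 * S k))))) by lia.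
rewrite 4!tech5, IH, tech5.
replace (4 * S k + 1)%nat with (S (4 * S k)) by lia.
replace (4 * S k + 2)%nat with (S (S (4 * S k))) by lia.
replace (4 * S k + 3)%nat with (S (S (S (4 * S k)))) by lia.
ring.
Qed.

(** The weights 1, -1, 0, 0 sum to zero, which removes the power of 16. The isolated 1 is the last
    binomial coefficient, outside the complete blocks. *)
Lemma binomial_mod4_difference (k : nat) :
  sum_f_R0 (fun i => C (4 * S k) (4 * i) - C (4 * S k) (4 * i + 1)) k + 1 =
  (-4) ^ S k / 2.
Proof.
transitivity (binomial_transform (periodic4 1 (-1) 0 0) (4 * S k));
  [| rewrite binomial_transform_periodic4; field].
unfold binomial_transform; rewrite sum_blocks4, C_n_n, periodic4_mul, Rmult_1_r.
f_equal; apply sum_eq; intros i _.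
rewrite (Nat.add_comm _ 1), (Nat.add_comm _ 2), (Nat.add_comm _ 3).
change (periodic4 1 (-1) 0 0 (1 + 4 * i)) with (periodic4 (-1) 0 0 1 (4 * i)).
change (periodic4 1 (-1) 0 0 (2 + 4 * i)) with (periodic4 0 0 1 (-1) (4 * i)).
change (periodic4 1 (-1) 0 0 (3 + 4 * i))
  with (periodic4 0 1 (-1) 0 (4 * i)).
rewrite !periodic4_mul; ring.
Qed.

Lemma sum_f_R0_rev (f : nat -> R) (n : nat) :
  sum_f_R0 (fun i => f (n - i)%nat) n = sum_f_R0 f n.
Proof.
induction n as [| n IH]; [reflexivity |].
rewrite decomp_sum, tech5 by lia; simpl pred.
rewrite Nat.sub_0_r, Rplus_comm; f_equal; exact IH.
Qed.

(** * The explicit parametrization *)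

(** For [i <= k], iterating the coefficient shift gives [(-1)^i] times twice the prescribed
    coefficient of [z ^ 2] at index [k - i]; the signs combine to [(-1)^k]. *)
Definition sol_p (c00 : R) (k i : nat) : R :=
  2 * c00 * (-1) ^ k / INR (fact (4 * (k - i))).

(** The factor [4 * (k - i)] gives the required zero at [i = k]. *)
Definition sol_q (c00 : R) (k i : nat) : R :=
  - (2 * c00 * (-1) ^ k * INR (4 * (k - i)) / INR (fact (4 * (k - i)))).

Definition sol (c00 : R) (k m : nat) (z : R) : R :=
  dbeam (sol_p c00 k) (sol_q c00 k) k m z.

Lemma sol_deriv (c00 : R) (k m : nat) :
  derivative_on (sol c00 k m) (sol c00 k (S m)).
Proof. apply dbeam_deriv. Qed.

Lemma sol_at_0 (c00 : R) (k : nat) : sol c00 k 0 0 = 0 /\ sol c00 k 1 0 = 0.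
Proof. unfold sol; rewrite !dbeam_at_0 by lia; auto. Qed.

Lemma sol_fourth_0 (c00 z : R) : sol c00 0 4 z = 0.
Proof. apply dbeam_fourth_0. Qed.

(** Apart from the sign [(-1)^k] the coefficients depend only on [k - i], so raising both indices
    changes just the sign. *)
Lemma sol_fourth_S (c00 : R) (k : nat) (z : R) :
  sol c00 (S k) 4 z = - sol c00 k 0 z.
Proof.
transitivity (-1 * sol c00 k 0 z); [| ring].
unfold sol; rewrite dbeam_fourth_S; unfold dbeam; rewrite scal_sum.
apply sum_eq; intros i _; unfold sol_p, sol_q.
rewrite Nat.sub_succ; simpl pow; unfold Rdiv; ring.
Qed.

(** Writing [1 / (4i-1)!] this way also covers [i = 0], where the derivative vanishes. *)
Lemma dmono_third_at_1 (i : nat) :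
  dmono (4 * i + 2) 3 1 = INR (4 * i) / INR (fact (4 * i)).
Proof.
destruct i as [| i].
- unfold dmono; simpl; field.
- rewrite dmono_ge by lia; rewrite pow1.
  replace (4 * S i)%nat with (S (4 * i + 3)) by lia.
  replace (S (4 * i + 3) + 2 - 3)%nat with (4 * i + 3)%nat by lia.
  rewrite fact_simpl, mult_INR.
  field; split; [apply INR_fact_neq_0 | apply not_0_INR; lia].
Qed.

Lemma sol_third_at_1 (c00 : R) (k : nat) : sol c00 k 3 1 = 0.
Proof.
set (u := fun n => INR (4 * n) / INR (fact (4 * n))).
set (v := fun n => / INR (fact (4 * n))).
unfold sol, dbeam.
rewrite (sum_eq _ (fun i => (v (k - i)%nat * u i - u (k - i)%nat * v i)
                            * (2 * c00 * (-1) ^ k))).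
- rewrite <- scal_sum, minus_sum.
  (* Reversal turns the first convolution into the second. *)
  rewrite <- (sum_f_R0_rev (fun i => v (k - i)%nat * u i)).
  rewrite (sum_eq (fun i => v (k - (k - i))%nat * u (k - i)%nat)
                  (fun i => u (k - i)%nat * v i)); [ring |].
  intros i Hi; replace (k - (k - i))%nat with i by lia; ring.
- intros i _; rewrite dmono_third_at_1, dmono_ge by lia.
  replace (4 * i + 3 - 3)%nat with (4 * i)%nat by lia.
  rewrite pow1; unfold sol_p, sol_q, u, v, Rdiv; ring.
Qed.

(** Exceptional case: the binomial sum is 1 here, not [(-4)^0 / 2]. *)
Lemma sol_second_at_1_0 (c00 : R) : sol c00 0 2 1 = 2 * c00.
Proof. unfold sol, dbeam, sol_p, sol_q, dmono; simpl; field. Qed.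

Lemma sol_second_at_1_S (c00 : R) (k : nat) :
  sol c00 (S k) 2 1 = 4 ^ S k / INR (fact (4 * S k)) * c00.
Proof.
transitivity (2 * c00 * (-1) ^ S k / INR (fact (4 * S k)) * ((-4) ^ S k / 2)).
2:{ replace (4 ^ S k) with ((-1) ^ S k * (-4) ^ S k)
      by (rewrite <- Rpow_mult_distr; f_equal; ring).
    field; apply INR_fact_neq_0. }
rewrite <- binomial_mod4_difference, Rmult_plus_distr_l, scal_sum.
unfold sol, dbeam; rewrite tech5; f_equal.
- apply sum_eq; intros i Hi; rewrite !dmono_ge, !pow1 by lia.
  replace (4 * i + 2 - 2)%nat with (4 * i)%nat by lia.
  replace (4 * i + 3 - 2)%nat with (4 * i + 1)%nat by lia.
  unfold sol_p, sol_q, C.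
  replace (4 * S k - 4 * i)%nat with (4 * (S k - i))%nat by lia.
  (* Exposes the factor [4 * (S k - i)] of the factorial, nonzero as [i <= k], which cancels against
     the one in [sol_q]. *)
  replace (4 * (S k - i))%nat with (S (4 * S k - (4 * i + 1))) by lia.
  rewrite (fact_simpl (4 * S k - (4 * i + 1))), mult_INR.
  field; repeat split; try apply INR_fact_neq_0; apply not_0_INR; lia.
(* In the top block [sol_q] vanishes; the rest matches the isolated 1. *)
- rewrite !dmono_ge, !pow1 by lia; unfold sol_p, sol_q.
  replace (4 * S k + 2 - 2)%nat with (4 * S k)%nat by lia.
  rewrite Nat.sub_diag, Nat.mul_0_r; simpl (INR 0); simpl (fact 0).
  change (INR 1) with 1.
  field; split; apply INR_fact_neq_0.
Qed.

Definition sol_c (c00 : R) (k i : nat) : R :=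
  sol_p c00 k i / INR (fact (4 * i + 2)).

Definition sol_d (c00 : R) (k i : nat) : R :=
  sol_q c00 k i / INR (fact (4 * i + 3)).

Lemma sol_c_0 (c00 : R) (k : nat) :
  sol_c c00 k 0 = (-1) ^ k / INR (fact (4 * k)) * c00.
Proof.
unfold sol_c, sol_p; rewrite Nat.sub_0_r; simpl (fact (4 * 0 + 2)).
simpl (INR 2); field; apply INR_fact_neq_0.
Qed.

Lemma sol_parametrization (c00 : R) :
  beam_parametrization c00 (fun k => sol c00 k 0) (fun k => sol c00 k 2 1)
    (sol_c c00) (sol_d c00).
Proof.
split; [| split; [split |]].
- exists (fun k => sol c00 k 1), (fun k => sol c00 k 2), (fun k => sol c00 k 3).
  repeat split; try (intros; apply sol_deriv); try apply sol_at_0;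
    try apply sol_third_at_1.
  + apply (derivative_on_ext (sol c00 0 3) _ (sol c00 0 4)); auto.
    * intros; apply sol_fourth_0.
    * apply sol_deriv.
  + intros k; apply (derivative_on_ext (sol c00 (S k) 3) _ (sol c00 (S k) 4)); auto.
    * intros; apply sol_fourth_S.
    * apply sol_deriv.
- intros k z _; unfold sol, dbeam; apply sum_eq; intros i _.
  rewrite !dmono_ge, !Nat.sub_0_r by lia; unfold sol_c, sol_d, Rdiv; ring.
- intros k; unfold sol_d, sol_q; rewrite Nat.sub_diag, Nat.mul_0_r.
  simpl (INR 0); unfold Rdiv; ring.
- apply sol_c_0.
Qed.

(** * Uniqueness and the closed formulas *)

Lemma beam_parametrization_unique (c00 : R) (alpha : nat -> R -> R)
    (beta : nat -> R) (c d : nat -> nat -> R) :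
  beam_parametrization c00 alpha beta c d ->
  forall k : nat,
    (forall z, unit_interval z -> alpha k z = sol c00 k 0 z) /\
    beta k = sol c00 k 2 1 /\
    d k 0%nat = sol_d c00 k 0.
Proof.
intros [[a1 [a2 [a3 [Hder [H0 [HS Hbc]]]]]] [[Hpoly _] Hc]].
assert (U0 : unit_interval 0) by (unfold unit_interval; lra).
assert (U1 : unit_interval 1) by (unfold unit_interval; lra).
(* Derivatives on [0,1] are unique, so [a2] and [a3] are those of the polynomial and can be read off
   at 0. *)
assert (Hcoef : forall k, a2 k 0 = 2 * c k 0%nat /\ a3 k 0 = 6 * d k 0%nat).
{ intros k.
  set (P := dbeam (fun i => c k i * INR (fact (4 * i + 2)))
                  (fun i => d k i * INR (fact (4 * i + 3))) k).
  assert (E0 : forall z, unit_interval z -> alpha k z = P 0%nat z).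
  { intros z Hz; rewrite (Hpoly k z Hz); unfold P, dbeam.
    apply sum_eq; intros i _; rewrite !dmono_ge, !Nat.sub_0_r by lia.
    field; split; apply INR_fact_neq_0. }
  destruct (Hder k) as [D1 [D2 D3]].
  pose proof (derivative_on_unique _ _ _ _ D1 (dbeam_deriv _ _ _ _) E0) as E1.
  pose proof (derivative_on_unique _ _ _ _ D2 (dbeam_deriv _ _ _ _) E1) as E2.
  pose proof (derivative_on_unique _ _ _ _ D3 (dbeam_deriv _ _ _ _) E2) as E3.
  rewrite (E2 0 U0), (E3 0 U0), !dbeam_at_0 by lia; simpl; split; ring. }
assert (Hind : forall k,
  derivative_on (fun z => a3 k z - sol c00 k 3 z) (fun _ => 0) ->
  forall z, unit_interval z ->
    alpha k z - sol c00 k 0 z = 0 /\ a2 k z - sol c00 k 2 z = 0 /\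
    a3 k z - sol c00 k 3 z = 0).
{ intros k H4.
  destruct (Hder k) as [D1 [D2 D3]].
  destruct (Hbc k) as [B0 [B1 [_ B3]]].
  destruct (sol_at_0 c00 k) as [S0 S1].
  apply (beam_homogeneous_zero _ (fun z => a1 k z - sol c00 k 1 z)); auto;
    try (apply derivative_on_minus; auto using sol_deriv); simpl.
  - rewrite B0, S0; ring.
  - rewrite B1, S1; ring.
  - rewrite (proj1 (Hcoef k)), Hc, <- sol_c_0; unfold sol.
    rewrite dbeam_at_0 by lia; unfold sol_c; simpl; field.
  - rewrite B3, sol_third_at_1; ring. }
assert (Hall : forall k z, unit_interval z ->
    alpha k z - sol c00 k 0 z = 0 /\ a2 k z - sol c00 k 2 z = 0 /\
    a3 k z - sol c00 k 3 z = 0).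
(* The fourth derivative of the difference is minus the previous difference, zero by induction. *)
{ induction k as [| k IH]; apply Hind.
  - apply (derivative_on_ext (fun z => a3 0%nat z - sol c00 0 3 z) _
             (fun z => 0 - sol c00 0 4 z)); auto.
    + intros z _; rewrite sol_fourth_0; ring.
    + apply derivative_on_minus; auto using sol_deriv.
  - apply (derivative_on_ext (fun z => a3 (S k) z - sol c00 (S k) 3 z) _
             (fun z => - alpha k z - sol c00 (S k) 4 z)); auto.
    + intros z Hz; rewrite sol_fourth_S; destruct (IH z Hz); lra.
    + apply derivative_on_minus; auto using sol_deriv. }
intros k; split; [| split].
- intros z Hz; destruct (Hall k z Hz); lra.
- destruct (Hall k 1 U1) as [_ [H2 _]]; destruct (Hbc k) as [_ [_ [B2 _]]]; lra.
- destruct (Hall k 0 U0) as [_ [_ H3]]; rewrite (proj2 (Hcoef k)) in H3.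
  unfold sol in H3; rewrite dbeam_at_0 in H3 by lia; simpl in H3.
  unfold sol_d; simpl; lra.
Qed.

(** The formulas are computed for [sol] and carried over by uniqueness; existence shows that they
    are not vacuous. *)
Theorem mainTheorem3 (c00 : R) :
  (exists (alpha : nat -> R -> R) (beta : nat -> R) (c d : nat -> nat -> R),
     beam_parametrization c00 alpha beta c d) /\
  (forall (alpha : nat -> R -> R) (beta : nat -> R) (c d : nat -> nat -> R),
     beam_parametrization c00 alpha beta c d ->
     (forall k : nat,
        d k 0%nat =
        - (INR (4 * k) * (-1) ^ k / (3 * INR (fact (4 * k)))) * c00) /\
     beta 0%nat = 2 * c00 /\
     (forall k : nat, (1 <= k)%nat ->
        beta k = 4 ^ k / INR (fact (4 * k)) * c00) /\
     (c00 = 2 ->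
        (forall (k : nat) (z : R), unit_interval z ->
           alpha k z =
           4 * (-1) ^ k *
           sum_f_R0 (fun i =>
             1 / (INR (fact (4 * i + 2)) * INR (fact (4 * (k - i)))) *
               z ^ (4 * i + 2) -
             INR (4 * (k - i)) /
               (INR (fact (4 * i + 3)) * INR (fact (4 * (k - i)))) *
               z ^ (4 * i + 3)) k) /\
        beta 0%nat = 4 /\
        (forall k : nat, (1 <= k)%nat ->
           beta k = 2 * (4 ^ k / INR (fact (4 * k)))))).
Proof.
split.
{ exists (fun k => sol c00 k 0), (fun k => sol c00 k 2 1), (sol_c c00), (sol_d c00).
  apply sol_parametrization. }
intros alpha beta c d H.
pose proof (beam_parametrization_unique c00 alpha beta c d H) as Huniq.
assert (Hbeta0 : beta 0%nat = 2 * c00).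
{ rewrite (proj1 (proj2 (Huniq 0%nat))); apply sol_second_at_1_0. }
assert (HbetaS : forall k : nat, (1 <= k)%nat ->
          beta k = 4 ^ k / INR (fact (4 * k)) * c00).
{ intros [| k] Hk; [lia |].
  rewrite (proj1 (proj2 (Huniq (S k)))); apply sol_second_at_1_S. }
split; [| split; [exact Hbeta0 | split; [exact HbetaS |]]].
- intros k; rewrite (proj2 (proj2 (Huniq k))).
  (* The factor 1/3 arises as [2 / 3!]. *)
  unfold sol_d, sol_q; rewrite Nat.sub_0_r; change (fact (4 * 0 + 3)) with 6%nat.
  replace (INR 6) with 6 by (simpl; ring).
  field; apply INR_fact_neq_0.
- intros Hc00; split; [| split].
  + intros k z Hz; rewrite (proj1 (Huniq k) z Hz), scal_sum.
    unfold sol, dbeam; apply sum_eq; intros i _.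
    rewrite !dmono_ge, !Nat.sub_0_r by lia.
    unfold sol_p, sol_q; rewrite Hc00.
    field; repeat split; apply INR_fact_neq_0.
  + rewrite Hbeta0, Hc00; ring.
  + intros k Hk; rewrite (HbetaS k Hk), Hc00; ring.
Qed.
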